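(* Let $q$ be a prime power and let $n,m$ be integers with $m>n^2$; set $Q=q^m$. Let $\boldsymbol\beta$ be chosen uniformly at random in $\mathbb F_Q^n$. For any $r\times n$ matrix $\mathbf H$ over $\mathbb F_q$ and any column vector $\mathbf s\in\mathbb F_q^r$, let $w_H$ be the minimum Hamming weight of a vector $x\in\mathbb F_q^n$ with $\mathbf H\,{}^t x=\mathbf s$, and let $w_R$ be the minimum rank weight of a vector $\mathbf x\in\mathbb F_Q^n$ with $\mathbf H(\boldsymbol\beta)\,{}^t\mathbf x=\mathbf s$. Then the probability that $w_H\neq w_R$ is bounded above by a quantity (independent of $\mathbf H$, $\mathbf s$ and $m$) that tends to $0$ exponentially fast in $n$.
   Context: $\mathbf H(\boldsymbol\beta)$ denotes the $r\times n$ matrix over $\mathbb F_Q$ given by $[\beta_1\mathbf h_1,\dots,\beta_n\mathbf h_n]$, where $\mathbf h_1,\dots,\mathbf h_n$ are the columns of $\mathbf H$. The rank weight of $\mathbf y=(y_1,\dots,y_n)\in\mathbb F_Q^n$ is the dimension over $\mathbb F_q$ of the $\mathbb F_q$-span of $y_1,\dots,y_n$. Minimum over an empty set is taken to be $+\infty$. *)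

(* Defs.v *)
From HB Require Import structures.
From mathcomp Require Import all_boot all_order all_algebra all_field.
From mathcomp Require Import constructive_ereal reals.

Set Implicit Arguments.
Unset Strict Implicit.
Unset Printing Implicit Defensive.

Import Order.TTheory GRing.Theory Num.Theory.
Local Open Scope ring_scope.

Definition prime_power (q : nat) : Prop :=
  exists p e : nat, [/\ prime p, (0 < e)%N & q = (p ^ e)%N].

Definition hamming_weight (K : fieldType) (n : nat) (x : 'rV[K]_n) : nat :=
  #|[set i | x 0 i != 0]|.

(* The dimension is over the base field K, not over the entries' field L. *)
Definition rank_weight (K : fieldType) (L : fieldExtType K) (n : nat)
    (y : 'rV[L]_n) : nat :=
  \dim <<[seq y 0%R i | i : 'I_n]>>%VS.

(* The neutral element +oo is the value for an empty set of candidates. *)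
Definition min_weight (R : realType) (T : finType) (P : pred T)
    (wt : T -> nat) : \bar R :=
  \big[mine/+oo%E]_(x | P x) (wt x)%:R%:E.

Section Weights.
Variables (R : realType) (F : finFieldType) (L : fieldExtType F).
Variables (r n : nat) (H : 'M[F]_(r, n)) (s : 'cV[F]_r).

Definition min_hamming_weight : \bar R :=
  min_weight R [pred x : 'rV[F]_n | H *m x^T == s] (@hamming_weight F n).

Definition scale_columns (beta : 'rV[L]_n) : 'M[L]_(r, n) :=
  \matrix_(i, j) (H i j *: beta 0 j).

(* finvect_type L is L itself, with its finite type structure;
   in_alg L is the inclusion of F in L. *)
Definition min_rank_weight (beta : 'rV[L]_n) : \bar R :=
  min_weight R
    [pred x : 'rV[finvect_type L]_n |
       scale_columns beta *m (x : 'rV[L]_n)^T == map_mx (in_alg L) s]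
    (@rank_weight F L n).

End Weights.

Definition uniform_prob (R : realType) (T : finType) (E : {set T}) : R :=
  #|E|%:R / #|T|%:R.

Definition exponentially_small (R : realType) (f : nat -> R) : Prop :=
  exists C rho : R, 0 < rho < 1 /\ forall n, `|f n| <= C * rho ^+ n.

(* Main.v *)
(** If every [beta_i] is nonzero then [x |-> (x_i / beta_i)_i] turns solutions
    over F into solutions of no larger rank weight, so [w_R <= w_H];
    some [beta_i] vanishes with probability at most [n / Q].

    Conversely, suppose [w_R < w_H = w + 1].  A vector [y] of rank weight at most
    [w] factors as [e A] with [e] in [L^w] and [A] a [w x n] matrix over F, which
    leaves [Q^w q^(wn)] candidates.  For a fixed [y], the equation
    [H(beta) y = s] reads [M beta = s] with [M = H diag(y)].  If it is solvable it
    has a solution supported on [rank M] coordinates, and an F-linear retraction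
    L -> F carries the resulting combination of columns of [H] to one over F;
    hence [rank M >= w + 1] and at most [Q^(n-w-1)] vectors [beta] satisfy it.
    Summing over [y], the probability is at most [q^(wn) / Q <= q^-n]. *)

Require Import Defs.
From HB Require Import structures.
From mathcomp Require Import all_boot all_order all_algebra all_field.
From mathcomp Require Import mxabelem zify.
From mathcomp Require Import constructive_ereal reals.

Set Implicit Arguments.
Unset Strict Implicit.
Unset Printing Implicit Defensive.

Import Order.TTheory GRing.Theory Num.Theory.
Local Open Scope ring_scope.

(** * Linear systems over a field: sparse solutions and their number *)

Lemma exists_sparse_solution (K : fieldType) (r n : nat) (M : 'M[K]_(r, n))
    (s : 'cV[K]_r) (y : 'rV[K]_n) :
  M *m y^T = s ->
  exists2 z : 'rV[K]_n, M *m z^T = s & (hamming_weight z <= \rank M)%N.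
Proof.
move=> My; set f := maxrankfun M^T.
have /submxP[D sD] : (s^T <= rowsub f M^T)%MS.
  by rewrite eq_maxrowsub -My trmx_mul trmxK submxMl.
(* The rows of [M^T] picked by [f] form a basis of its row space; [rowsub f 1%:M] spreads the
   coefficients [D] over those positions and puts zeros elsewhere. *)
exists (D *m rowsub f 1%:M).
  by rewrite -[LHS]trmxK trmx_mul trmxK -mulmxA mul_rowsub_mx mul1mx -sD trmxK.
rewrite -[X in (_ <= X)%N]mxrank_tr -[X in (_ <= X)%N]card_ord.
apply: leq_trans (leq_imset_card f predT); apply/subset_leq_card/subsetP => j.
rewrite inE mxE; apply: contraNT => fj; apply/eqP/big1 => k _.
rewrite !mxE; case: eqP => [fk|_]; last by rewrite mulr0.
by rewrite -fk imset_f in fj.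
Qed.

(** A nonempty solution set is a translate of the kernel of [M^T]. *)
Lemma card_solutions_le (K : finFieldType) (r n : nat) (M : 'M[K]_(r, n))
    (s : 'cV[K]_r) :
  (#|[set b : 'rV[K]_n | M *m b^T == s]| <= #|K| ^ (n - \rank M))%N.
Proof.
have [->|[b0]] := set_0Vmem [set b : 'rV[K]_n | M *m b^T == s].
  by rewrite cards0.
rewrite inE => /eqP Mb0.
rewrite -mxrank_tr -mxrank_ker -card_rowg.
rewrite -(card_imset _ (addIr (- b0))); apply/subset_leq_card/subsetP.
move=> _ /imsetP[b + ->]; rewrite !inE => /eqP Mb; apply/sub_kermxP.
by apply: trmx_inj; rewrite trmx_mul trmxK linearB mulmxBr Mb0 Mb subrr trmx0.
Qed.

(** * Descent from [L] to [F], and rank weight *)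

Section FieldExtension.
Variables (F : fieldType) (L : fieldExtType F).

(** An [F]-linear retraction of the inclusion of [F] in [L], along the complement of the line of 1
    that [projv] chooses. *)
Definition base_coord (v : L) : F := coord [tuple 1 : L] ord0 (projv 1%VS v).

Lemma base_coord_scale (a : F) (v : L) : base_coord (a *: v) = a * base_coord v.
Proof. by rewrite /base_coord !linearZ. Qed.

Lemma base_coord_sum (I : finType) (v : I -> L) :
  base_coord (\sum_i v i) = \sum_i base_coord (v i).
Proof. by rewrite /base_coord !linear_sum. Qed.

Lemma base_coordA (a : F) : base_coord a%:A = a.
Proof.
rewrite /base_coord projv_id ?rpredZ ?mem1v // linearZ /=.
have -> : coord [tuple 1 : L] ord0 (1 : L) = 1.
  by rewrite (coord_free ord0 ord0) ?seq1_free ?oner_eq0.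
exact: mulr1.
Qed.

Lemma base_solution (r n : nat) (H : 'M[F]_(r, n)) (s : 'cV[F]_r)
    (z : 'rV[L]_n) :
  map_mx (in_alg L) H *m z^T = map_mx (in_alg L) s ->
  H *m (map_mx base_coord z)^T = s.
Proof.
move=> /matrixP Hz; apply/matrixP => i j.
have /(congr1 base_coord) := Hz i j.
rewrite !mxE base_coord_sum base_coordA => <-.
by apply: eq_bigr => k _; rewrite !mxE mulr_algl base_coord_scale.
Qed.

Lemma hamming_base_coord (n : nat) (z : 'rV[L]_n) :
  (hamming_weight (map_mx base_coord z) <= hamming_weight z)%N.
Proof.
apply/subset_leq_card/subsetP => i; rewrite !inE mxE.
by apply: contraNneq => ->; rewrite -(scale0r (1 : L)) base_coordA.
Qed.

Lemma exists_base_solution (r n : nat) (H : 'M[F]_(r, n)) (s : 'cV[F]_r)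
    (b y : 'rV[L]_n) :
  map_mx (in_alg L) H *m diag_mx y *m b^T = map_mx (in_alg L) s ->
  exists2 x : 'rV[F]_n, H *m x^T = s &
    (hamming_weight x <= \rank (map_mx (in_alg L) H *m diag_mx y))%N.
Proof.
move=> /exists_sparse_solution[z Hz wz].
(* The sparse [z] replaces [b]; neither multiplying by [y] entrywise nor the retraction enlarges its
   support. *)
exists (map_mx base_coord (z *m diag_mx y)).
  by apply: base_solution; rewrite trmx_mul tr_diag_mx mulmxA.
apply: leq_trans (hamming_base_coord _) _; apply: leq_trans wz.
apply/subset_leq_card/subsetP => i; rewrite !inE mul_mx_diag mxE.
by apply: contraNneq => ->; rewrite mul0r.
Qed.

Lemma rank_weight_le_hamming (n : nat) (y : 'rV[L]_n) :
  (rank_weight y <= hamming_weight y)%N.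
Proof.
rewrite /rank_weight /hamming_weight cardE.
set t := enum _; rewrite -(size_map (y 0)); apply: leq_trans (dim_span _).
apply/dimvS/span_subvP => _ /imageP[i _ ->].
have [->|yi] := eqVneq (y 0 i) 0; first exact: mem0v.
by apply/memv_span/map_f; rewrite mem_enum inE.
Qed.

Lemma rank_weight_factor (n w : nat) (y : 'rV[L]_n) : (rank_weight y <= w)%N ->
  exists (e : 'rV[L]_w) (A : 'M[F]_(w, n)), y = e *m map_mx (in_alg L) A.
Proof.
rewrite /rank_weight; set U := (<<_>>%VS) => Uw.
pose d := \dim U; pose B := vbasis U.
(* A basis of the span has [d <= w] elements. For indices from [d] on, [nth] and [insub] fall back
   to 0, which pads both factors up to [w]. *)
exists (\row_j B`_j), (\matrix_(j, i)
  oapp (fun k => coord B k (y 0 i)) 0 (insub (val j))).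
apply/matrixP => i0 i; rewrite ord1 mxE.
have yU : y 0 i \in U by apply/memv_span/map_f; rewrite mem_enum.
pose c k := oapp (fun k => coord B k (y 0 i)) 0 (insub k).
transitivity (\sum_(k < d) c k *: B`_k).
  rewrite [LHS](coord_vbasis yU); apply: eq_bigr => k _.
  by rewrite /c valK.
rewrite (big_ord_widen w (fun k => c k *: B`_k)) // big_mkcond /=.
apply: eq_bigr => k _; rewrite !mxE mulr_algr.
by case: ltnP => // dk; rewrite nth_default ?scaler0 // size_tuple.
Qed.

End FieldExtension.

(** Since [b] and [y] enter symmetrically, fixing [y] leaves a linear system in [b]. *)
Lemma scale_columnsE (F : finFieldType) (L : fieldExtType F) (r n : nat)
    (H : 'M[F]_(r, n)) (b y : 'rV[L]_n) :
  scale_columns H b *m y^T = map_mx (in_alg L) H *m diag_mx y *m b^T.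
Proof.
rewrite -mulmxA; apply/matrixP => i j; rewrite !mxE; apply: eq_bigr => k _.
by rewrite ord1 mul_diag_mx !mxE mulr_algl -scalerAl [_ * y _ _]mulrC.
Qed.

Lemma card_bigcup_le (I T : finType) (A : I -> {set T}) (B : nat) :
  (forall i, #|A i| <= B)%N -> (#|\bigcup_i A i| <= #|I| * B)%N.
Proof.
move=> AB; rewrite -sum_nat_const.
elim/big_rec2: _ => [|i u v _ le_vu]; first by rewrite cards0.
by rewrite (leq_trans (leq_card_setU _ _)) ?leq_add.
Qed.

Lemma min_weight_le (R : realType) (T : finType) (P : pred T) (wt : T -> nat)
    (x : T) : P x -> (min_weight R P wt <= (wt x)%:R%:E)%O.
Proof. by move=> Px; apply: (bigmin_inf x). Qed.

(** * Counting the vectors [b] for which the two weights differ *)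

Section FiniteExtension.
Variables (F : finFieldType) (L : fieldExtType F).
Variables (r n : nat) (H : 'M[F]_(r, n)) (s : 'cV[F]_r).

Local Notation K := (finvect_type L).

Definition rank_solution (b y : 'rV[L]_n) : bool :=
  scale_columns H b *m y^T == map_mx (in_alg L) s.

Lemma card_rank_solution_le (k : nat) (y : 'rV[K]_n) :
  (forall x : 'rV[F]_n, H *m x^T = s -> k <= hamming_weight x)%N ->
  (#|[set b : 'rV[K]_n | rank_solution b y]| <= #|K| ^ (n - k))%N.
Proof.
move=> hk; have [->|[b0]] := set_0Vmem [set b : 'rV[K]_n | rank_solution b y].
  by rewrite cards0.
rewrite inE /rank_solution scale_columnsE => /eqP/exists_base_solution[x Hx xr].
pose M : 'M[K]_(r, n) := map_mx (in_alg L) H *m diag_mx (y : 'rV[L]_n).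
have kM : (n - \rank M <= n - k)%N by rewrite leq_sub2l ?(leq_trans (hk _ Hx)).
have K0 : (0 < #|K|)%N by apply/card_gt0P; exists 0.
apply: leq_trans (leq_pexp2l K0 kM).
apply: leq_trans (card_solutions_le M (map_mx (in_alg L) s)).
apply/subset_leq_card/subsetP => b.
by rewrite !inE /rank_solution scale_columnsE.
Qed.

(** Union bound over the pairs [(e, A)] of a factorisation; a vector [y] reached from several pairs
    is merely counted again. *)
Lemma card_low_rank_le (w : nat) :
  (forall x : 'rV[F]_n, H *m x^T = s -> w < hamming_weight x)%N ->
  (#|[set b : 'rV[K]_n | [exists y : 'rV[K]_n,
       (rank_weight (y : 'rV[L]_n) <= w) && rank_solution b y]]|
   <= #|K| ^ w * #|F| ^ (w * n) * #|K| ^ (n - w.+1))%N.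
Proof.
move=> hw; rewrite -[w in (#|K| ^ w)%N]mul1n -!card_mx -card_prod.
pose Y (u : 'rV[K]_w * 'M[F]_(w, n)) : 'rV[K]_n :=
  (u.1 : 'rV[L]_w) *m map_mx (in_alg L) u.2.
apply: leq_trans (card_bigcup_le (fun u => card_rank_solution_le (Y u) hw)).
apply/subset_leq_card/subsetP => b; rewrite inE => /existsP[y /andP[yw by_]].
have [e [A yE]] := rank_weight_factor yw.
by apply/bigcupP; exists ((e : 'rV[K]_w), A); rewrite // inE /Y /= -yE.
Qed.

Lemma card_zero_entry_le :
  (#|[set b : 'rV[K]_n | [exists i, b ord0 i == 0%R]]| <= n * #|K| ^ n.-1)%N.
Proof.
rewrite -[X in (X * _)%N]card_ord.
have Bi (i : 'I_n) : (#|[set b : 'rV[K]_n | b ord0 i == 0%R]| <= #|K| ^ n.-1)%N.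
  (* Deleting entry [i] is injective on the vectors that vanish there. *)
  rewrite -[n.-1]mul1n -card_mx -(card_in_imset (f := col' i)).
    exact: max_card.
  move=> b c; rewrite !inE => /eqP b0 /eqP c0 /matrixP bc.
  apply/rowP => j; case: (unliftP i j) => [j' ->|->]; last by rewrite b0 c0.
  by have := bc ord0 j'; rewrite !mxE.
apply: leq_trans (card_bigcup_le Bi); apply/subset_leq_card/subsetP => b.
by rewrite inE => /existsP[i bi]; apply/bigcupP; exists i; rewrite ?inE.
Qed.

Lemma min_rank_le_hamming (R : realType) (b : 'rV[K]_n) :
  (forall i, b ord0 i != 0) ->
  (min_rank_weight R H s (b : 'rV[L]_n) <= min_hamming_weight R H s)%O.
Proof.
move=> b0; apply/bigmin_geP; split=> [|x /eqP Hx]; first exact: leey.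
pose y : 'rV[K]_n := \row_i ((x 0 i)%:A / (b 0 i : L)).
have yx : (rank_weight (y : 'rV[L]_n) <= hamming_weight x)%N.
  apply: leq_trans (rank_weight_le_hamming _) _.
  apply/subset_leq_card/subsetP => i; rewrite !inE mxE.
  by apply: contraNneq => ->; rewrite scale0r mul0r.
apply: (le_trans (@min_weight_le R _ _ _ y _)); last by rewrite lee_fin ler_nat.
rewrite /= -Hx; apply/eqP/matrixP => i j; rewrite !mxE rmorph_sum.
apply: eq_bigr => k _; rewrite !mxE ord1 /=.
by rewrite -scalerAl mulrC divfK ?b0 // scalerA.
Qed.

Lemma min_rank_lt_hamming (R : realType) (b : 'rV[K]_n) :
  (min_rank_weight R H s (b : 'rV[L]_n) < min_hamming_weight R H s)%O ->
  exists2 y : 'rV[K]_n, rank_solution b y &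
   forall x : 'rV[F]_n, H *m x^T = s ->
     (rank_weight (y : 'rV[L]_n) < hamming_weight x)%N.
Proof.
move=> lt_w.
have /existsP[y /andP[by_ yw]] : [exists y : 'rV[K]_n, rank_solution b y &&
  ((rank_weight (y : 'rV[L]_n))%:R%:E < min_hamming_weight R H s)%O].
  (* If every candidate had weight at least [w_H], so would the minimum, whose starting value is
     +oo. *)
  apply: contraLR lt_w => /existsPn noy; rewrite -leNgt.
  apply/bigmin_geP; split=> [|y Py]; first exact: leey.
  by have := noy y; rewrite negb_and -leNgt => /orP[/negP[]|].
exists y => // x Hx; rewrite -(ltr_nat R) -lte_fin.
by apply: (lt_le_trans yw); apply: min_weight_le; apply/eqP.
Qed.

Lemma card_rank_lt_hamming_le (R : realType) (m : nat) :
  (n ^ 2 < m)%N -> (#|K| = #|F| ^ m)%N ->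
  (#|[set b : 'rV[K]_n | (min_rank_weight R H s (b : 'rV[L]_n)
        < min_hamming_weight R H s)%O]| * #|F| ^ n <= #|K| ^ n)%N.
Proof.
move=> hm hL; set G := [set b | _].
(* One bad [b0] already makes the system over [F] solvable, so [w_H] is attained, at [x1]. It
   exceeds the weight of [y0], hence is a successor [w.+1], the same for all [b]. *)
have [->|[b0]] := set_0Vmem G; first by rewrite cards0.
rewrite inE => /min_rank_lt_hamming[y0 by0 y0w].
move: by0; rewrite /rank_solution scale_columnsE.
case/eqP/exists_base_solution=> x0 /eqP Hx0 _.
case: (arg_minnP (P := fun x : 'rV[F]_n => H *m x^T == s)
  (@hamming_weight F n) Hx0) => x1 /eqP Hx1 x1min.
have x1n : (hamming_weight x1 <= n)%N by rewrite -[leqRHS]card_ord max_card.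
case kE : (hamming_weight x1) (y0w _ Hx1) => [|w] // _.
have hw (x : 'rV[F]_n) : H *m x^T = s -> (w < hamming_weight x)%N.
  by move/eqP/x1min; rewrite kE.
rewrite kE in x1n.
have q0 : (0 < #|F|)%N by apply/card_gt0P; exists 0.
apply: (@leq_trans ((#|K| ^ w * #|F| ^ (w * n) * #|K| ^ (n - w.+1)) * #|F| ^ n)%N).
  rewrite leq_mul2r; apply/orP; right; apply: leq_trans (card_low_rank_le hw).
  apply/subset_leq_card/subsetP => b.
  rewrite !inE => /min_rank_lt_hamming[y byy yw]; apply/existsP; exists y.
  by rewrite byy andbT -ltnS -kE yw.
(* The product equals [Q^(n-1) q^((w+1)n)], and [(w+1)n <= n^2 <= m] bounds the second factor by
   [Q]. *)
rewrite -mulnA mulnACA -!expnD -mulSnr.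
rewrite -[in leqRHS](subnK x1n) addnS expnSr addnC leq_mul2l; apply/orP; right.
rewrite hL leq_pexp2l // (leq_trans _ (ltnW hm)) // leq_mul2r.
by rewrite x1n orbT.
Qed.

Lemma card_hamming_lt_rank_le (R : realType) (m : nat) :
  (n ^ 2 < m)%N -> (#|K| = #|F| ^ m)%N ->
  (#|[set b : 'rV[K]_n | (min_hamming_weight R H s
        < min_rank_weight R H s (b : 'rV[L]_n))%O]| * #|F| ^ n <= #|K| ^ n)%N.
Proof.
move=> hm hL.
apply: (@leq_trans (n * #|K| ^ n.-1 * #|F| ^ n)%N).
  rewrite leq_mul2r; apply/orP; right; apply: leq_trans card_zero_entry_le.
  apply/subset_leq_card/subsetP => b; rewrite !inE.
  by apply: contraTT => /existsPn b0; rewrite -leNgt min_rank_le_hamming.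
have [-> //|n0] := posnP n.
rewrite mulnAC -[in leqRHS](prednK n0) expnS leq_mul2r; apply/orP; right.
have q1 : (1 < #|F|)%N by exact: finNzRing_gt1.
(* It remains to show [n q^n <= Q]: use [n <= q^n], then [2n <= n^2 + 1 <= m]. *)
apply: (@leq_trans (#|F| ^ n * #|F| ^ n)%N).
  by rewrite leq_mul2r (ltnW (ltn_expl n q1)) orbT.
rewrite -expnD hL leq_exp2l //; nia.
Qed.

Lemma card_weights_neq_le (R : realType) (m : nat) :
  (n ^ 2 < m)%N -> (#|K| = #|F| ^ m)%N ->
  (#|[set b : 'rV[K]_n | min_hamming_weight R H s
        != min_rank_weight R H s (b : 'rV[L]_n)]| * #|F| ^ n
   <= 2 * #|K| ^ n)%N.
Proof.
move=> hm hL; rewrite mul2n -addnn.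
apply: leq_trans (leq_add (card_hamming_lt_rank_le R hm hL)
                          (card_rank_lt_hamming_le R hm hL)).
rewrite -mulnDl leq_mul2r; apply/orP; right.
apply: leq_trans (leq_card_setU _ _); apply/subset_leq_card/subsetP => b.
by rewrite !inE neq_lt.
Qed.

End FiniteExtension.

Theorem mainTheorem8 (R : realType) (q : nat) (hq : prime_power q) :
  exists eps : nat -> R, exponentially_small eps /\
    forall (n m : nat) (hm : (n ^ 2 < m)%N)
      (F : finFieldType) (L : fieldExtType F)
      (hF : #|F| = q) (hL : #|finvect_type L| = (q ^ m)%N)
      (r : nat) (H : 'M[F]_(r, n)) (s : 'cV[F]_r),
      uniform_prob R [set beta : 'rV[finvect_type L]_n |
        min_hamming_weight R H s != min_rank_weight R H s (beta : 'rV[L]_n)]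
      <= eps n.
Proof.
have q1 : (1 < q)%N.
  case: hq => p [e [p_prime e0 ->]].
  by rewrite -(exp1n e) ltn_exp2r ?prime_gt1.
have q0 : (0 : R) < q%:R by rewrite ltr0n ltnW.
(* Each of the two strict orderings of the weights has probability at most [q^-n]. *)
exists (fun n => 2 * q%:R^-1 ^+ n); split.
  exists 2, q%:R^-1; split=> [|n].
    by rewrite invr_gt0 q0 invf_lt1 // ltr1n.
  by rewrite ger0_norm // mulr_ge0 ?exprn_ge0 ?invr_ge0 // ltW.
move=> n m hm F L hF hL r H s.
rewrite -hF in hL q0 *.
have := card_weights_neq_le H s R hm hL.
rewrite /uniform_prob card_mx mul1n; set N := #|_| => leN.
have K0 : (0 < #|finvect_type L| ^ n)%N.
  by rewrite expn_gt0 hL expn_gt0 -(ltr0n R) q0.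
by rewrite ler_pdivrMr ?ltr0n // exprVn mulrAC ler_pdivlMr ?exprn_gt0 //
  -natrX -!natrM ler_nat.
Qed.
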